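(* Let $S$ be an ai-semiring, and let $n\geq 2$ be an integer. Then the matrix semiring $\mathbf{M}_n(S)$ can be embedded into $\mathbf{M}_{n+1}(S)$; that is, there is an injective map $\mathbf{M}_n(S)\to\mathbf{M}_{n+1}(S)$ preserving addition and multiplication.
   Context: An ai-semiring (additively idempotent semiring) is an algebra $(S,+,\cdot)$ such that $(S,+)$ is a commutative idempotent semigroup, $(S,\cdot)$ is a semigroup, and $x(y+z)=xy+xz$, $(x+y)z=xz+yz$ hold (no additive or multiplicative identity element, and in particular no zero, is required). For an ai-semiring $S$ and $m\ge 2$, $\mathbf{M}_m(S)$ is the set of all $m\times m$ matrices over $S$ with entrywise addition and product $(AB)_{ij}=\sum_{k=1}^m A_{ik}B_{kj}$; it is an ai-semiring. *)

(* Defs.v *)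
From HB Require Import structures.
From mathcomp Require Import all_boot all_algebra.

Set Implicit Arguments.
Unset Strict Implicit.
Unset Printing Implicit Defensive.

Import GRing.Theory.
Local Open Scope ring_scope.

(* The additive law is [x + y] in [ring_scope], inherited from
   [baseAddMagmaType]; the multiplicative law is [x * y] in [group_scope],
   inherited from [magmaType] (the product of [ring_scope] belongs to
   semirings with a zero and a one). Neither parent structure carries a zero,
   a one or a choice operator. *)
HB.mixin Record isAISemiring S of Algebra.BaseAddMagma S & Magma S := {
  aiaddA : associative (@Algebra.add S);
  aiaddC : commutative (@Algebra.add S);
  aiaddxx : idempotent_op (@Algebra.add S);
  aimulA : associative (@monoid.mul S);
  aimulDl : left_distributive (@monoid.mul S) (@Algebra.add S);
  aimulDr : right_distributive (@monoid.mul S) (@Algebra.add S)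
}.

#[short(type="aiSemiringType")]
HB.structure Definition AISemiring :=
  {S of isAISemiring S & Algebra.BaseAddMagma S & Magma S}.

Section Sum.
Variable S : aiSemiringType.

Local Notation oadd := (oAC (@aiaddA S) (@aiaddC S)).

(* The sum of [F k] over all [k : 'I_m]. As [S] need not have a zero, it is
   computed in [option S], with [None] as the neutral element. The index [i]
   witnesses that ['I_m] is nonempty, so that the iterated sum is never [None]
   and the default value [F i] is never used (see [Some_aisum]). *)
Definition aisum m (i : 'I_m) (F : 'I_m -> S) : S :=
  odflt (F i) (\big[oadd/None]_(k < m) Some (F k)).

Lemma Some_aisum m (i : 'I_m) (F : 'I_m -> S) :
  Some (aisum i F) = \big[oadd/None]_(k < m) Some (F k).
Proof. by rewrite /aisum (bigD1 i) //=; case: (\big[_/_]_(_ | _) _). Qed.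

Lemma aisum_ord1 (i : 'I_1) (F : 'I_1 -> S) : aisum i F = F ord0.
Proof. by apply: Some_inj; rewrite Some_aisum big_ord1. Qed.

Lemma aisum_ord_recl m (i : 'I_m.+2) (F : 'I_m.+2 -> S) :
  aisum i F = F ord0 + aisum ord0 (fun k : 'I_m.+1 => F (lift ord0 k)).
Proof.
by apply: Some_inj; rewrite Some_aisum big_ord_recl -(Some_aisum ord0) oACE.
Qed.

Lemma eq_aisum m (i j : 'I_m) (F G : 'I_m -> S) :
  F =1 G -> aisum i F = aisum j G.
Proof.
move=> eqFG; apply: Some_inj; rewrite !Some_aisum.
by apply: eq_bigr => k _; rewrite eqFG.
Qed.

Lemma aisumD m (i : 'I_m) (F G : 'I_m -> S) :
  aisum i (fun k => F k + G k) = aisum i F + aisum i G.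
Proof.
apply: Some_inj; rewrite -[RHS](oACE (@aiaddA S) (@aiaddC S)) !Some_aisum.
by rewrite -big_split.
Qed.

Lemma aisum_morph m (i : 'I_m) (f : S -> S) (F : 'I_m -> S) :
  {morph f : x y / x + y} -> f (aisum i F) = aisum i (fun k => f (F k)).
Proof.
move=> fD; apply: Some_inj; rewrite -[LHS]/(omap f (Some _)) !Some_aisum.
apply: (big_morph (omap f)) => // -[x|] [y|] //=.
by rewrite !oACE fD.
Qed.

Lemma exchange_aisum m n (i : 'I_m) (j : 'I_n) (F : 'I_m -> 'I_n -> S) :
  aisum i (fun k => aisum j (F k)) = aisum j (fun l => aisum i (F^~ l)).
Proof.
apply: Some_inj; rewrite !Some_aisum.
under eq_bigr do rewrite Some_aisum.
by rewrite exchange_big; apply: eq_bigr => l _; rewrite Some_aisum.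
Qed.

End Sum.

(* The matrices ['M[S]_m], under a name of their own: ['M[S]_m] already has an
   addition when [S] is an [nmodType], which would clash with the one below. *)
Definition aimatrix (S : Type) (m : nat) : Type := 'M[S]_m.

Section Matrix.
Variables (S : aiSemiringType) (m : nat).
Implicit Types A B C : aimatrix S m.

Definition aiaddmx A B : aimatrix S m :=
  \matrix_(i < m, j < m) ((A : 'M_m) i j + (B : 'M_m) i j).

Definition aimulmx A B : aimatrix S m :=
  \matrix_(i < m, j < m)
    aisum i (fun k => ((A : 'M_m) i k * (B : 'M_m) k j)%g).

HB.instance Definition _ := Algebra.hasAdd.Build (aimatrix S m) aiaddmx.
HB.instance Definition _ := hasMul.Build (aimatrix S m) aimulmx.

Let aiaddmxA : associative aiaddmx.
Proof. by move=> A B C; apply/matrixP=> i j; rewrite !mxE aiaddA. Qed.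

Let aiaddmxC : commutative aiaddmx.
Proof. by move=> A B; apply/matrixP=> i j; rewrite !mxE aiaddC. Qed.

Let aiaddmxx : idempotent_op aiaddmx.
Proof. by move=> A; apply/matrixP=> i j; rewrite !mxE aiaddxx. Qed.

Let aimulmxA : associative aimulmx.
Proof.
move=> A B C; apply/matrixP=> i j; rewrite !mxE.
pose F k l := ((A : 'M_m) i k * (B : 'M_m) k l * (C : 'M_m) l j)%g.
transitivity (aisum i (fun k => aisum i (F k))).
  apply: eq_aisum => k; rewrite mxE.
  rewrite (aisum_morph _ _ (f := *%g ((A : 'M_m) i k))); last first.
    by move=> x y; rewrite aimulDr.
  by apply: eq_aisum => l; rewrite aimulA.
rewrite exchange_aisum; apply: eq_aisum => l; rewrite mxE.
rewrite (aisum_morph _ _ (f := fun x => (x * (C : 'M_m) l j)%g)) //.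
by move=> x y; rewrite aimulDl.
Qed.

Let aimulmxDl : left_distributive aimulmx aiaddmx.
Proof.
move=> A B C; apply/matrixP=> i j; rewrite !mxE -aisumD.
by apply: eq_aisum => k; rewrite mxE aimulDl.
Qed.

Let aimulmxDr : right_distributive aimulmx aiaddmx.
Proof.
move=> A B C; apply/matrixP=> i j; rewrite !mxE -aisumD.
by apply: eq_aisum => k; rewrite mxE aimulDr.
Qed.

HB.instance Definition _ := isAISemiring.Build (aimatrix S m)
  aiaddmxA aiaddmxC aiaddmxx aimulmxA aimulmxDl aimulmxDr.

End Matrix.

(* Main.v *)
Require Import Defs.
From mathcomp Require Import all_boot all_algebra.

(* Duplicating an index embeds the n x n matrices: pull A back along a
   surjection p from n+1 to n indices, sending A to (A_{p i, p j}). In a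
   product the repeated index contributes a repeated summand, which additive
   idempotency absorbs. No zero of S is needed, in contrast with bordering A
   by zeros. *)

Lemma aisum_absorb (S : aiSemiringType) (m : nat) (i j : 'I_m) (F : 'I_m -> S) :
  (F j + aisum i F)%R = aisum i F.
Proof.
apply: Some_inj; rewrite -(oACE (@aiaddA S) (@aiaddC S)) !Some_aisum.
(* The sum over the indices other than [j] is [None] exactly when [m] is 1. *)
rewrite (bigD1 j) //=; case: (\big[_/_]_(_ | _) _) => [x|]; rewrite !oACE.
  by rewrite aiaddA aiaddxx.
by rewrite aiaddxx.
Qed.

(** The default serves only the index [ord0], so indices 0 and 1 share the image 0. *)
Definition collapse (m : nat) (k : 'I_m.+2) : 'I_m.+1 :=
  odflt ord0 (unlift ord0 k).

Lemma collapse0 (m : nat) : collapse m ord0 = ord0.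
Proof. by rewrite /collapse unlift_none. Qed.

Lemma lift0K (m : nat) : cancel (lift ord0) (collapse m).
Proof. by move=> k; rewrite /collapse liftK. Qed.

Lemma aisum_collapse (S : aiSemiringType) (m : nat) (i : 'I_m.+2)
    (j : 'I_m.+1) (F : 'I_m.+1 -> S) :
  aisum i (fun k => F (collapse m k)) = aisum j F.
Proof.
rewrite aisum_ord_recl collapse0 -(aisum_absorb S m.+1 j ord0); congr (_ + _)%R.
by apply: eq_aisum => k; rewrite lift0K.
Qed.

Theorem theorem2p5 (S : aiSemiringType) (n : nat) (hn : (2 <= n)%N) :
  exists f : aimatrix S n -> aimatrix S n.+1,
    [/\ injective f,
        {morph f : A B / (A + B)%R}
      & {morph f : A B / (A * B)%g}].
Proof.
case: n hn => // m _.
exists (fun A => mxsub (collapse m) (collapse m) (A : 'M[S]_m.+1)).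
split=> [A B /matrixP eqAB|A B|A B]; apply/matrixP=> i j.
(* [lift ord0] is a section of [collapse m]: the entries at lifted indices recover the original
   matrix. *)
- by have := eqAB (lift ord0 i) (lift ord0 j); rewrite !mxE !lift0K.
- by rewrite !mxE.
(* Once the shorter sum is spread over ['I_m.+2], the products agree term by term. *)
- rewrite !mxE -(aisum_collapse S m i); apply: eq_aisum => k.
  by rewrite !mxE.
Qed.
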